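(* Let $1\le p<\infty$, $1\le q\le\infty$, $1\le\lambda<\infty$, and let $T:X\to Y$ be a bounded linear operator between complex Banach spaces $X$ and $Y$ with $\|T\|<\lambda^{1/p}$. Then for every $n\in\mathbb{N}$, $$A_p(B_{\ell^n_q},T,\lambda)\ge\frac{K^p(B_{\ell^n_q},T,\lambda)}{n^{1/q}}.$$
   Context: $B_{\ell^n_q}$ is the open unit ball of $\mathbb{C}^n$ with the $\ell_q$-norm, $1\le q\le\infty$; convention $1/\infty=0$. $\mathcal{H}_\infty(B_{\ell^n_q},X)$ is the set of all bounded holomorphic functions $f:B_{\ell^n_q}\to X$, with monomial expansion $f(z)=\sum_{\alpha\in\mathbb{N}_0^n}x_\alpha(f)z^\alpha$, $x_\alpha(f)\in X$, and $\|f\|_{B_{\ell^n_q}}=\sup_{z\in B_{\ell^n_q}}\|f(z)\|_X$. Arithmetic Bohr radius: $$A_p(B_{\ell^n_q},T,\lambda)=\sup\Big\{\tfrac1n\sum_{i=1}^n r_i \;:\; r=(r_1,\dots,r_n)\in\mathbb{R}^n_{\ge0},\ \sum_{\alpha\in\mathbb{N}_0^n}\|T(x_\alpha(f))\|_Y^p\, r^{p\alpha}\le\lambda\|f\|^p_{B_{\ell^n_q}}\ \text{for all } f\in\mathcal{H}_\infty(B_{\ell^n_q},X)\Big\},$$ where $r^{p\alpha}=\prod_i r_i^{p\alpha_i}$. Bohr radius: $K^p(B_{\ell^n_q},T,\lambda)$ is the supremum of all $R\ge0$ such that for all holomorphic functions $f(z)=\sum_{\alpha\in\mathbb{N}_0^n}x_\alpha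 z^\alpha$ on $B_{\ell^n_q}$ with values in $X$, $$\sup_{z\in R B_{\ell^n_q}}\sum_{\alpha\in\mathbb{N}_0^n}\|T(x_\alpha)z^\alpha\|_Y^p\le\lambda\sup_{z\in B_{\ell^n_q}}\|f(z)\|_X^p .$$ *)

(* Defs.v *)
From HB Require Import structures.
From mathcomp Require Import all_boot all_order all_algebra finmap.
From mathcomp Require Import complex.
From mathcomp Require Import all_classical all_reals all_analysis.
From mathcomp Require Import showcase.summability.

Set Implicit Arguments.
Unset Strict Implicit.
Unset Printing Implicit Defensive.
Import Order.TTheory GRing.Theory Num.Theory.
Import numFieldNormedType.Exports.

Local Open Scope classical_set_scope.
Local Open Scope ring_scope.
Local Open Scope complex_scope.

(* R[i] is a numClosedFieldType in the library, but carries no topology there: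
   give it the one of any numFieldType, i.e. that of its modulus. *)
HB.instance Definition _ (R : realType) :=
  PseudoMetric.copy R[i] ((R[i] : numFieldType)^o).
HB.instance Definition _ (R : realType) :=
  Pointed.copy R[i] ((R[i] : numFieldType)^o).

(* A complex Banach space is a [completeNormedModType R[i]].  Its norm takes
   values in the nonnegative reals of R[i]; [rnorm] is the same norm in R. *)
Definition rnorm (R : realType) (V : normedModType R[i]) (x : V) : R :=
  complex.Re `|x|.

Definition opnorm (R : realType) (X Y : normedModType R[i])
    (T : {linear X -> Y}) : \bar R :=
  ereal_sup [set (rnorm (T x))%:E | x in [set x : X | rnorm x <= 1]].

(* The exponent q ranges over extended reals; only 1 <= q <= +oo is meaningful
   and the value at q = -oo is junk. *)
Definition lqnorm (R : realType) (n : nat) (q : \bar R) (z : 'rV[R[i]]_n) : R :=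
  match q with
  | s%:E => (\sum_(i < n) complex.Re `|z ord0 i| `^ s) `^ s^-1
  | _ => \big[Num.max/0]_(i < n) complex.Re `|z ord0 i|
  end.

Definition lqball (R : realType) (n : nat) (q : \bar R) : set 'rV[R[i]]_n :=
  [set z | lqnorm q z < 1].

Definition multiindex (n : nat) := {ffun 'I_n -> nat}.

Definition monomial (R : realType) (n : nat) (z : 'rV[R[i]]_n)
    (a : multiindex n) : R[i] :=
  \prod_(i < n) z ord0 i ^+ a i.

(* Complex Frechet differentiability at each point of the (open) ball; functions
   are total and their values outside the ball are never used. *)
Definition holomorphic_on_ball (R : realType) (X : completeNormedModType R[i])
    (n : nat) (q : \bar R) (f : 'rV[R[i]]_n -> X) : Prop :=
  forall z : 'rV[R[i]]_n, lqball q z -> differentiable f z.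

Definition ball_norm (R : realType) (X : completeNormedModType R[i])
    (n : nat) (q : \bar R) (f : 'rV[R[i]]_n -> X) : \bar R :=
  ereal_sup [set (rnorm (f z))%:E | z in lqball q].

Definition Hoo (R : realType) (X : completeNormedModType R[i])
    (n : nat) (q : \bar R) : set ('rV[R[i]]_n -> X) :=
  [set f | holomorphic_on_ball q f /\ (ball_norm q f < +oo)%E].

(* [x] is the family of coefficients of f : the series of the x_a z^a, summed
   over the directed set of finite sets of multi-indices, converges to f z at
   every z in the ball.  For holomorphic f such a family exists and is unique. *)
Definition monomial_expansion (R : realType) (X : completeNormedModType R[i])
    (n : nat) (q : \bar R) (f : 'rV[R[i]]_n -> X) (x : multiindex n -> X) : Prop :=
  forall z : 'rV[R[i]]_n, lqball q z ->
    partial_sum (fun a => monomial z a *: x a) @ totally --> f z.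

(* The radii are extended reals: both suprema are +oo when T = 0. *)
Definition arithmetic_bohr_radius (R : realType) (X Y : completeNormedModType R[i])
    (n : nat) (p : R) (q : \bar R) (T : {linear X -> Y}) (lambda : R) : \bar R :=
  ereal_sup [set (n%:R^-1 * \sum_(i < n) r ord0 i)%:E | r in
    [set r : 'rV[R]_n | (forall i, 0 <= r ord0 i) /\
      forall (f : 'rV[R[i]]_n -> X) (x : multiindex n -> X),
        Hoo q f -> monomial_expansion q f x ->
        (\esum_(a in [set: multiindex n])
            (rnorm (T (x a)) `^ p * \prod_(i < n) r ord0 i `^ (p * (a i)%:R))%:E
          <= lambda%:E * ball_norm q f `^ p)%E]].

Definition bohr_radius (R : realType) (X Y : completeNormedModType R[i])
    (n : nat) (p : R) (q : \bar R) (T : {linear X -> Y}) (lambda : R) : \bar R :=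
  ereal_sup [set rho%:E | rho in
    [set rho : R | 0 <= rho /\
      forall (f : 'rV[R[i]]_n -> X) (x : multiindex n -> X),
        holomorphic_on_ball q f -> monomial_expansion q f x ->
        (ereal_sup [set \esum_(a in [set: multiindex n])
                          (rnorm (monomial z a *: T (x a)) `^ p)%:E
                     | z in [set rho%:C *: w | w in @lqball R n q]]
          <= lambda%:E * ball_norm q f `^ p)%E]].

(* Main.v *)
(* Fix an admissible radius rho for K^p and 0 < t < 1.  The constant vector
   (t / n^(1/q), ..., t / n^(1/q)) has l_q-norm t, so evaluating the Bohr
   inequality at rho times that vector says exactly that the constant radius
   r = (rho t / n^(1/q), ...) is admissible for A_p; its mean is
   rho t / n^(1/q).  Then let t tend to 1. *)
Require Import Defs.
From mathcomp Require Import all_boot all_order all_algebra.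
From mathcomp Require Import complex.
From mathcomp Require Import all_classical all_reals all_analysis.

Import Order.TTheory GRing.Theory Num.Theory.
Import numFieldNormedType.Exports.

Local Open Scope classical_set_scope.
Local Open Scope ring_scope.
Local Open Scope complex_scope.

Lemma Re_norm_real (R : realType) (s : R) : 0 <= s -> complex.Re `|s%:C| = s.
Proof. by move=> s0; rewrite normc_def /= expr0n addr0 sqrtr_sqr ger0_norm. Qed.

(** [fine q^-1] encodes 1/q with 1/oo = 0: at [q = +oo] the factor is [n^0 = 1], and [0 < n] keeps
    the maximum from being its default value 0. *)
Lemma lqnorm_const (R : realType) (n : nat) (q : \bar R) (s : R) :
  (0 < n)%N -> (1 <= q)%E -> 0 <= s ->
  lqnorm q (const_mx s%:C : 'rV_n) = n%:R `^ fine q^-1 * s.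
Proof.
move=> n0 q1 s0; rewrite /lqnorm; case: q q1 => [q||] // q1.
- have q0 : q != 0 by rewrite gt_eqF// (lt_le_trans ltr01)// -lee_fin.
  rewrite (eq_bigr (fun=> s `^ q)); last by move=> i _; rewrite mxE Re_norm_real.
  rewrite sumr_const card_ord -[_ *+ n]mulr_natl powRM ?powR_ge0//.
  by rewrite -powRrM mulfV// powRr1// inver (negbTE q0).
- rewrite (eq_bigr (fun=> s)); last by move=> i _; rewrite mxE Re_norm_real.
  rewrite invey /= powRr0 mul1r; apply/eqP; rewrite eq_le; apply/andP; split.
    exact: bigmax_le.
  exact: (le_bigmax _ _ (Ordinal n0)).
Qed.

(** Turns the summand of the Bohr inequality at a constant point into that of the arithmetic one at
    a constant radius. *)
Lemma rnorm_monomial_const (R : realType) (Y : normedModType R[i]) (n : nat)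
    (p s : R) (a : multiindex n) (y : Y) :
  0 <= s ->
  rnorm (monomial (const_mx s%:C) a *: y) `^ p =
  rnorm y `^ p * \prod_(i < n) s `^ (p * (a i)%:R).
Proof.
move=> s0.
have P0 : 0 <= \prod_(i < n) s ^+ a i by apply: prodr_ge0 => i _; exact: exprn_ge0.
have -> : monomial (const_mx s%:C) a = (\prod_(i < n) s ^+ a i)%:C.
  by rewrite rmorph_prod; apply: eq_bigr => i _; rewrite mxE rmorphXn.
have rnorm_ge0 : 0 <= rnorm y.
  by have := normr_ge0 y; rewrite lecE => /andP[].
have -> : rnorm ((\prod_(i < n) s ^+ a i)%:C *: y)
    = (\prod_(i < n) s ^+ a i) * rnorm y.
  rewrite /rnorm normrZ normc_def /= expr0n addr0 sqrtr_sqr ger0_norm//.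
  by case: (`|y|) => u v /=; rewrite mul0r subr0.
rewrite powRM// mulrC; congr (_ * _).
(* Real powers are multiplicative on nonnegative bases, so the exponent enters the product relative
   to [Num.nneg]. *)
rewrite (big_morph_in Num.nneg (fun x => x `^ p) (id1 := 1) (op1 := *%R))//.
- by apply: eq_bigr => i _; rewrite -powR_mulrn// -powRrM mulrC.
- by move=> u v u0 v0; rewrite rpredM.
- exact: rpred1.
- by move=> u v u0 v0; rewrite powRM.
- by rewrite powR1.
- by move=> i _; rewrite nnegrE exprn_ge0.
Qed.

Theorem lemma3p2 (R : realType) (X Y : completeNormedModType R[i])
    (p : R) (q : \bar R) (lambda : R) (T : {linear X -> Y})
    (hp : 1 <= p) (hq : (1 <= q)%E) (hlambda : 1 <= lambda)
    (hT : continuous T) (hTnorm : (opnorm T < (lambda `^ p^-1)%:E)%E)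
    (n : nat) (hn : (0 < n)%N) :
  (bohr_radius n p q T lambda / (n%:R `^ fine q^-1)%:E
     <= arithmetic_bohr_radius n p q T lambda)%E.
Proof.
set c := n%:R `^ fine q^-1.
have c0 : 0 < c by rewrite powR_gt0// ltr0n.
(* Moving [c] to the right leaves a bare supremum, so bounding each admissible [rho] is enough. *)
rewrite inver gt_eqF// lee_pdivrMr//; apply: ge_ereal_sup => _ [rho [rho0 hrho] <-].
rewrite -lee_pdivrMr//.
(* The factor [t < 1] is there because the ball is open: the constant vector with entries [1 / c]
   has norm exactly 1. *)
rewrite -EFinM; apply/lee_mul01Pr; first by rewrite lee_fin divr_ge0// ltW.
move=> t /andP[t0 t1].
have tc0 : 0 <= t / c by rewrite divr_ge0// ltW.
pose s := rho * (t / c).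
have s0 : 0 <= s by rewrite mulr_ge0.
apply: ereal_sup_ubound; exists (const_mx s).
  split=> [i|f x [hol _] fx]; first by rewrite mxE.
  (* Both inequalities have the same right-hand side; it remains to exhibit the sum as one of the
     values in the supremum over the scaled ball. *)
  apply: le_trans (hrho f x hol fx).
  apply: ereal_sup_ubound; exists (const_mx s%:C).
    exists (const_mx (t / c)%:C); last first.
      by apply/matrixP => i j; rewrite !mxE -rmorphM.
    by rewrite /lqball /= lqnorm_const// mulrCA divff ?gt_eqF// mulr1.
  apply: eq_esum => a _; rewrite rnorm_monomial_const//.
  by congr (_ * _)%:E; apply: eq_bigr => i _; rewrite mxE.
rewrite (eq_bigr (fun=> s)); last by move=> i _; rewrite mxE.
rewrite sumr_const card_ord -[s *+ n]mulr_natl mulKf ?pnatr_eq0 -?lt0n//.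
by rewrite /s mulrCA EFinM.
Qed.
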